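(* Universal left-stability of Banach spaces is invariant under linear isomorphism: if $X$ and $Z$ are real Banach spaces that are linearly isomorphic (i.e. there is a bounded linear bijection of $X$ onto $Z$ with bounded inverse) and $X$ is universally left-stable, then $Z$ is universally left-stable.
   Context: All Banach spaces are real. For $\varepsilon\ge0$, a map $f:X\to Y$ between Banach spaces (not assumed linear, continuous or surjective) is called a standard $\varepsilon$-isometry if $f(0)=0$ and $\big|\|f(x)-f(y)\|-\|x-y\|\big|\le\varepsilon$ for all $x,y\in X$. For such $f$, $L(f)=\overline{\mathrm{span}}\,f(X)$ denotes the closed linear span of $f(X)$ in $Y$. A Banach space $X$ is universally left-stable if for every Banach space $Y$ there is a finite constant $\gamma>0$ such that for every $\varepsilon\ge0$ and every standard $\varepsilon$-isometry $f:X\to Y$ there exists a bounded linear operator $T:L(f)\to X$ with $\|Tf(x)-x\|\le\gamma\varepsilon$ for all $x\in X$. *)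

(* Defs.v *)
From mathcomp Require Import all_boot all_order all_algebra.
From mathcomp Require Import all_classical all_reals all_analysis.
Set Implicit Arguments.
Unset Strict Implicit.
Unset Printing Implicit Defensive.
Import Order.TTheory GRing.Theory Num.Theory.
Import numFieldNormedType.Exports.
Local Open Scope classical_set_scope.
Local Open Scope ring_scope.

Definition standard_eps_isometry (R : realType) (X Y : completeNormedModType R)
    (eps : R) (f : X -> Y) : Prop :=
  f 0 = 0 /\ forall x y : X, `| `|f x - f y| - `|x - y| | <= eps.

Definition linear_span (R : realType) (V : completeNormedModType R)
    (A : set V) : set V :=
  [set y | exists (n : nat) (a : 'I_n -> R) (v : 'I_n -> V),
     (forall i, A (v i)) /\ y = \sum_(i < n) a i *: v i].

Definition closed_linear_span (R : realType) (V : completeNormedModType R)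
    (A : set V) : set V :=
  closure (linear_span A).

(* An operator whose domain is a linear subspace D of V is represented by a
   total function on V whose values outside D are irrelevant: linearity and
   boundedness are only required on D. *)
Definition linear_on (R : realType) (V W : completeNormedModType R)
    (D : set V) (T : V -> W) : Prop :=
  forall (a : R) (u v : V), D u -> D v -> T (a *: u + v) = a *: T u + T v.

Definition bounded_on (R : realType) (V W : completeNormedModType R)
    (D : set V) (T : V -> W) : Prop :=
  exists M : R, forall v : V, D v -> `|T v| <= M * `|v|.

Definition universally_left_stable (R : realType)
    (X : completeNormedModType R) : Prop :=
  forall Y : completeNormedModType R,
  exists2 gamma : R, 0 < gamma &
    forall (eps : R) (f : X -> Y), 0 <= eps -> standard_eps_isometry eps f ->
    exists T : Y -> X,
      [/\ linear_on (closed_linear_span (range f)) T,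
          bounded_on (closed_linear_span (range f)) T
        & forall x : X, `|T (f x) - x| <= gamma * eps].

Definition linearly_isomorphic (R : realType)
    (X Z : completeNormedModType R) : Prop :=
  exists (u : {linear X -> Z}) (v : Z -> X),
    [/\ cancel u v, cancel v u, bounded_on [set: X] u & bounded_on [set: Z] v].

(* Main.v *)
From HB Require Import structures.
Require Import Defs.
From mathcomp Require Import all_boot all_order all_algebra.
From mathcomp Require Import all_classical all_reals all_analysis.
From mathcomp Require Import ring lra.

(** The proof transports an eps-isometry out of Z to an eps'-isometry out of X
with values in one Banach space that does not depend on the given map, namely
the space l_oo(X) of bounded real functions on the set X.

Let u : X -> Z be the isomorphism, v its inverse, B a bound for v, and let
f : Z -> Y be a standard eps-isometry.  Choose for every x in X a functional
xi_x of norm at most one with xi_x(x) = |x|.  The functionals xi_x o v on Z have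
norm at most B, and weak stability ([weak_stability]) provides functionals phi_x
on Y of norm at most B such that phi_x o f stays within 3 eps B of xi_x o v.
Together they form a bounded operator S : Y -> l_oo(X) for which S o f o u is
uniformly close to the isometric embedding x |-> (xi_i(x))_i.  Hence
g = S o f o u is a standard (6 B eps)-isometry from X to l_oo(X).  Stability of
X for the single target l_oo(X) gives a constant gamma and an operator T with
|T g(x) - x| <= 6 gamma B eps, and u o T o S is the operator required for f.

Weak stability rests on the inequality
  |sum_i l_i z_i| <= |sum_i l_i f(z_i)| + 3 eps sum_i |l_i|
([eps_isometry_combination]); the functional phi then comes from the Hahn-Banach
theorem.  To prove the inequality, note that f(a) - f(-a) has norm at least
2|a| - eps, so that the triangle inequality bounds |sum_i l_i f(z_i)| from below
by the sum of the terms |l_i| (|a| - |a - sgn(l_i) z_i|), up to an error of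
3 eps |l_i| each, for every a ([norm_controlled]).  Were the norm
differentiable, the terms would tend to the values of a linear functional as a
goes to infinity along a ray.  In place of differentiability, a sublinear p,
initially the norm, is replaced by p_e(x) = lim_{t -> oo} p(x + t e) - t p(e)
([straighten]), which is sublinear, at most p and linear along e.  The lower
bound passes to p_e because it holds at all points a, hence at a + t e.  Doing
this first for z = sum_i l_i z_i and then for each z_i leaves a sublinear function that is
linear on the span of the z_i, takes the value |z| at z, and still satisfies
the lower bound, which for a = 0 is the inequality.

The same passage from p to p_e proves the Hahn-Banach theorem, since it shows
that minimal sublinear functions are linear. *)

Set Implicit Arguments.
Unset Strict Implicit.
Unset Printing Implicit Defensive.
Import Order.TTheory GRing.Theory Num.Theory.
Import numFieldNormedType.Exports.
Local Open Scope classical_set_scope.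
Local Open Scope ring_scope.

(** * The Banach space of bounded real functions *)

Section linf.
Context (I : Type) (R : realType).

Definition bounded_family : {pred I -> R^o} :=
  fun f => `[< exists M : R, forall i, `|f i| <= M >].

Lemma bounded_family_submod_closed : submod_closed bounded_family.
Proof.
split; first by apply/asboolP; exists 0 => i; rewrite normr0.
move=> a f g /asboolP[M fM] /asboolP[N gN].
apply/asboolP; exists (`|a| * M + N) => i.
rewrite (le_trans (ler_normD _ _))// lerD// normrM.
by rewrite ler_wpM2l.
Qed.

HB.instance Definition _ :=
  GRing.isSubmodClosed.Build R (I -> R^o) bounded_family bounded_family_submod_closed.

Record linf := Linf { linf_val :> I -> R^o; _ : linf_val \in bounded_family }.

HB.instance Definition _ := [isSub for linf_val].
HB.instance Definition _ := [Choice of linf by <:].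
HB.instance Definition _ := [SubChoice_isSubLmodule of linf by <:].

Implicit Types f g : linf.

Lemma linf_bounded f : exists M : R, forall i, `|f i| <= M.
Proof. by case: f => f /= /asboolP. Qed.

(** When [I] is empty this is the supremum of the empty set, which is 0. *)
Definition linf_norm f : R := sup (range (fun i => `|f i|)).

Lemma linf_norm_ub f i : `|f i| <= linf_norm f.
Proof.
have [M fM] := linf_bounded f.
apply: ub_le_sup; last by exists i.
by exists M => _ [j _ <-].
Qed.

Lemma linf_norm_le f (M : R) : 0 <= M -> (forall i, `|f i| <= M) -> linf_norm f <= M.
Proof.
move=> M0 fM; rewrite /linf_norm.
have [->|/set0P r0] := eqVneq (range (fun i => `|f i|)) set0.
  by rewrite sup0.
by apply: ge_sup => // _ [i _ <-].
Qed.

Lemma linf_norm_ge0 f : 0 <= linf_norm f.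
Proof.
rewrite /linf_norm.
have [->|/set0P[_ [i _ _]]] := eqVneq (range (fun i => `|f i|)) set0.
  by rewrite sup0.
exact: le_trans (linf_norm_ub f i).
Qed.

Lemma linf_normD f g : linf_norm (f + g) <= linf_norm f + linf_norm g.
Proof.
apply: linf_norm_le => [|i]; first by rewrite addr_ge0 ?linf_norm_ge0.
by rewrite (le_trans (ler_normD _ _))// lerD// linf_norm_ub.
Qed.

Lemma linf_normZ_le (a : R) f : linf_norm (a *: f) <= `|a| * linf_norm f.
Proof.
apply: linf_norm_le => [|i]; first by rewrite mulr_ge0 ?linf_norm_ge0.
by rewrite /= normrM ler_wpM2l// linf_norm_ub.
Qed.

Lemma linf_normZ (a : R) f : linf_norm (a *: f) = `|a| * linf_norm f.
Proof.
apply/eqP; rewrite eq_le linf_normZ_le/=.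
have [->|a0] := eqVneq a 0; first by rewrite normr0 mul0r linf_norm_ge0.
rewrite -ler_pdivlMl ?normr_gt0// -normfV.
by rewrite -{1}[f](scalerK a0) linf_normZ_le.
Qed.

Lemma linf_norm0_eq0 f : linf_norm f = 0 -> f = 0.
Proof.
move=> f0; apply/val_inj/funext => i /=.
by apply/eqP; rewrite -normr_le0 -f0 linf_norm_ub.
Qed.

HB.instance Definition _ :=
  Lmodule_isNormed.Build R linf linf_normD linf_normZ linf_norm0_eq0.

Lemma linf_complete (F : set_system linf) : ProperFilter F -> cauchy F -> cvg F.
Proof.
move=> FF Fc.
have Fe (e : R) : 0 < e ->
    \forall f & g \near F, forall i, `|(f : linf) i - (g : linf) i| <= e.
  move=> e0; have /cauchy_ballP/(_ _ e0) := Fc.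
  apply: filterS => -[f g]; rewrite -ball_normE => fg i.
  exact: le_trans (linf_norm_ub (f - g) i) (ltW fg).
have cvgi i : cvg ((fun f : linf => f i : R^o) @ F).
  apply: R_complete; apply/cauchy_ballP => e e0.
  have e20 : 0 < e / 2 by rewrite divr_gt0.
  near_simpl; have := Fe _ e20; apply: filterS => -[f g] /(_ i) fg.
  rewrite -ball_normE /ball_/= (le_lt_trans fg)//.
  by rewrite ltr_pdivrMr// ltr_pMr// ltr1n.
pose h : I -> R^o := fun i => lim ((fun f : linf => f i : R^o) @ F).
(* The Cauchy estimate is uniform in the coordinate, so it survives the passage
   to the coordinatewise limit in one of its two arguments. *)
have hF (e : R) : 0 < e -> \forall f \near F, forall i, `|h i - (f : linf) i| <= e.
  move=> e0; have e20 : 0 < e / 2 by rewrite divr_gt0.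
  near=> f => i.
  near F => g.
  rewrite (splitr e) -(subrKA (g i)) (le_trans (ler_normD _ _))// lerD//.
    near: g; have /cvgrPdist_le := cvgi i; exact.
  rewrite distrC.
  suff : forall i, `|f i - g i| <= e / 2 by [].
  near: g; near: f; apply: nearP_dep; exact: Fe.
have hb : h \in bounded_family.
  near F => f.
  have [M fM] := linf_bounded f.
  apply/asboolP; exists (1 + M) => i.
  rewrite -[h i](subrK (f i)) (le_trans (ler_normD _ _))// lerD//.
  suff : forall i, `|h i - f i| <= 1 by [].
  by near: f; exact: hF.
apply/cvg_ex; exists (Linf hb).
apply/cvgrPdist_le => e e0; near=> f.
apply: (linf_norm_le (ltW e0)).
by near: f; exact: hF.
Unshelve. all: by end_near. Qed.

HB.instance Definition _ := Uniform_isComplete.Build linf linf_complete.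
End linf.

(** * Sublinear functions and the Hahn-Banach theorem *)

Section sublinear.
Context (R : realType) (V : lmodType R).
Implicit Types (p q : V -> R) (x y e : V).

Definition sublinear p :=
  (forall x y, p (x + y) <= p x + p y) /\
  (forall (a : R) x, 0 <= a -> p (a *: x) = a * p x).

Lemma sublinear0 p : sublinear p -> p 0 = 0.
Proof. by move=> [_ pZ]; rewrite -[X in p X](scale0r 0) pZ ?mul0r. Qed.

Lemma sublinear_geN p x : sublinear p -> - p (- x) <= p x.
Proof.
by move=> sp; rewrite -subr_ge0 opprK -(sublinear0 sp) -(subrr x) sp.1.
Qed.

Lemma sublinear_sum (T : Type) p (s : seq T) (F : T -> V) : sublinear p ->
  p (\sum_(i <- s) F i) <= \sum_(i <- s) p (F i).
Proof.
move=> sp; elim: s => [|i s IH]; first by rewrite !big_nil sublinear0.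
by rewrite !big_cons (le_trans (sp.1 _ _))// lerD2l.
Qed.

Definition infimum (I : Type) (D : set I) (F : I -> V -> R) x : R :=
  inf [set F i x | i in D].

Section infimum.
Variables (I : Type) (D : set I) (F : I -> V -> R).
Hypothesis Flb : forall x, exists M : R, forall i, D i -> M <= F i x.

Lemma infimum_le i x : D i -> infimum D F x <= F i x.
Proof.
move=> Di; apply: ge_inf; last by exists i.
by have [M FM] := Flb x; exists M => _ [j Dj <-]; exact: FM.
Qed.

Hypothesis D0 : D !=set0.

Lemma infimum_ge x (M : R) : (forall i, D i -> M <= F i x) -> M <= infimum D F x.
Proof.
move=> MF; apply: lb_le_inf.
  by have [i Di] := D0; exists (F i x), i.
by move=> _ [i Di <-]; exact: MF.
Qed.

Lemma infimum_approx x (e : R) : 0 < e ->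
  exists2 i, D i & F i x < infimum D F x + e.
Proof.
move=> e0.
have [|_ [i Di <-] ?] := @inf_adherent _ [set F i x | i in D] _ e0.
  split.
    by have [i Di] := D0; exists (F i x), i.
  by have [M FM] := Flb x; exists M => _ [j Dj <-]; exact: FM.
by exists i.
Qed.

(** The members of the family need not be sublinear themselves: addition
and scaling may change the index.  This form covers a
decreasing chain of sublinear functions, the limit defining [straighten], and
the infimal convolution in [weak_stability]. *)
Lemma infimum_sublinear :
  (forall i j x y, D i -> D j -> exists2 k, D k & F k (x + y) <= F i x + F j y) ->
  (forall i (a : R) x, D i -> 0 < a -> exists2 k, D k & F k (a *: x) <= a * F i x) ->
  sublinear (infimum D F).
Proof.
move=> FD FZ.
have ZZ (a : R) x : 0 < a -> infimum D F (a *: x) <= a * infimum D F x.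
  move=> a0; rewrite -ler_pdivrMl//; apply: infimum_ge => i Di.
  rewrite ler_pdivrMl//; have [k Dk Fk] := FZ i a x Di a0.
  by apply: le_trans Fk; exact: infimum_le.
have EE (a : R) x : 0 < a -> infimum D F (a *: x) = a * infimum D F x.
  move=> a0; apply/eqP; rewrite eq_le ZZ//=.
  rewrite -ler_pdivlMl// -{1}[x](scalerK (lt0r_neq0 a0)).
  by apply: ZZ; rewrite invr_gt0.
split=> [x y|a x].
  rewrite -lerBlDr; apply: infimum_ge => i Di.
  rewrite lerBlDr -lerBlDl; apply: infimum_ge => j Dj.
  rewrite lerBlDl; have [k Dk Fk] := FD i j x y Di Dj.
  by apply: le_trans Fk; exact: infimum_le.
rewrite le_eqVlt => /predU1P[<-|]; last exact: EE.
rewrite scale0r mul0r.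
have := EE 2 0 (ltr0Sn _ _); rewrite scaler0; lra.
Qed.
End infimum.

(** The family decreases in [t], so this is the limit of p (x + t e) - t p e as
t tends to infinity: the directional derivative of [p] at [e], when [p] is the
norm.  It is the largest sublinear function below [p] that is linear along
[e] and agrees with [p] at [e]. *)
Definition straighten p e : V -> R :=
  infimum [set t : R | 0 <= t] (fun t x => p (x + t *: e) - t * p e).

Section straighten.
Variables (p : V -> R) (e : V).
Hypothesis sp : sublinear p.

Let nonneg_neq0 : [set t : R | 0 <= t] !=set0.
Proof. by exists 0 => /=. Qed.

(* Subadditivity gives p (t e) <= p (x + t e) + p (- x). *)
Let lower x : exists M : R, forall t, 0 <= t -> M <= p (x + t *: e) - t * p e.
Proof.
exists (- p (- x)) => t t0.
by rewrite lerBrDr addrC lerBlDr -sp.2// (le_trans _ (sp.1 _ _))// addrAC subrr add0r.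
Qed.

Lemma straighten_sublinear : sublinear (straighten p e).
Proof.
apply: infimum_sublinear => //= [t u x y t0 u0|t a x t0 a0].
  exists (t + u); first exact: addr_ge0.
  by rewrite scalerDl (addrACA x) mulrDl opprD [leRHS]addrACA lerD2r sp.1.
exists (a * t); first by rewrite mulr_ge0// ltW.
by rewrite -scalerA -scalerDr (sp.2 _ _ (ltW a0)) mulrBr mulrA.
Qed.

Lemma straighten_le_at t x : 0 <= t -> straighten p e x <= p (x + t *: e) - t * p e.
Proof. by move=> t0; exact: (infimum_le lower). Qed.

Lemma straighten_le x : straighten p e x <= p x.
Proof. by have := straighten_le_at x (lexx 0); rewrite scale0r addr0 mul0r subr0. Qed.

(** Together with [straighten_le] at [e], this makes [straighten p e] linear on
the line through [e].  Both inequalities persist for every smaller sublinear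
function, so later straightenings do not destroy the linearity gained. *)
Lemma straightenN : straighten p e (- e) <= - p e.
Proof.
have := straighten_le_at (- e) ler01.
by rewrite scale1r addNr (sublinear0 sp) mul1r sub0r.
Qed.

(** By monotonicity in [t], one value of [t] can serve finitely many points. *)
Lemma straighten_approx (s : seq V) (d : R) : 0 < d -> exists2 t, 0 <= t &
  forall x, x \in s -> p (x + t *: e) - t * p e <= straighten p e x + d.
Proof.
move=> d0; elim: s => [|x s [t t0 IH]]; first by exists 0.
have [u /= u0 xu] := infimum_approx lower nonneg_neq0 x d0.
have mono y r1 r2 : 0 <= r1 -> 0 <= r2 ->
    p (y + (r1 + r2) *: e) - (r1 + r2) * p e <= p (y + r1 *: e) - r1 * p e.
  move=> r10 r20; rewrite scalerDl addrA.
  by rewrite lerBlDr mulrDl addrA subrK -sp.2// sp.1.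
exists (u + t); first exact: addr_ge0.
move=> y; rewrite inE => /predU1P[->|ys].
  exact: le_trans (mono _ _ _ u0 t0) (ltW xu).
by rewrite (addrC u); apply: le_trans (IH _ ys); exact: mono.
Qed.

End straighten.

(** Zorn's lemma yields a minimal sublinear function below [q].  It coincides with
all its straightenings, hence is linear along every line, and a sublinear
function that is odd is linear. *)
Theorem hahn_banach q : sublinear q ->
  exists2 phi : V -> R^o, linear phi & forall x, phi x <= q x.
Proof.
move=> sq.
pose T := {p : V -> R | sublinear p /\ forall x, p x <= q x}.
pose r (p p' : T) := `[< forall x, sval p' x <= sval p x >].
have [||||[p [sp pq]] pmin] := @Zorn T r.
- by move=> p; apply/asboolP.
- by move=> a b c /asboolP ab /asboolP bc; apply/asboolP => x; exact: le_trans (ab x).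
- move=> [a sa] [b sb] /asboolP /= ab /asboolP /= ba; apply: eq_exist => /=.
  by apply/funext => x; apply/le_anti; rewrite ab ba.
- move=> A Atot.
  have [A0|/set0P A0] := eqVneq A set0.
    by exists (exist _ q (conj sq (fun x => lexx _))) => s; rewrite A0.
  pose F (a : T) := sval a.
  have Flb x : exists M : R, forall a, A a -> M <= F a x.
    exists (- q (- x)) => a _; rewrite /F; case: a => a [/= sa aq].
    by apply: le_trans (sublinear_geN _ sa); rewrite lerN2.
  have sF : sublinear (infimum A F).
    apply: infimum_sublinear => // [a b x y Aa Ab|a c x Aa c0].
      have [/asboolP ab|/asboolP ba] := Atot a b Aa Ab.
        exists b => //; apply: le_trans ((svalP b).1.1 _ _) _.
        by rewrite lerD2r; exact: ab.
      exists a => //; apply: le_trans ((svalP a).1.1 _ _) _.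
      by rewrite lerD2l; exact: ba.
    by exists a => //; rewrite /F ((svalP a).1.2 _ _ (ltW c0)).
  have Fq x : infimum A F x <= q x.
    have [a Aa] := A0; apply: le_trans (infimum_le Flb _ Aa) _.
    exact: (svalP a).2.
  exists (exist _ (infimum A F) (conj sF Fq)) => a Aa; apply/asboolP => x /=.
  exact: infimum_le.
have pN e : p (- e) <= - p e.
  have se : sublinear (straighten p e) /\ forall x, straighten p e x <= q x.
    split=> [|x]; first exact: straighten_sublinear.
    exact: le_trans (straighten_le e sp x) (pq x).
  have /(congr1 sval)/= {1}<- :=
    pmin (exist _ (straighten p e) se) (asboolT (straighten_le e sp)).
  exact: straightenN.
have pD x y : p (x + y) = p x + p y.
  apply/le_anti; rewrite sp.1/= -lerBrDr.
  have := sp.1 (x + y) (- y); rewrite addrK => h; apply: le_trans h _.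
  by rewrite lerD2l.
have pNE x : p (- x) = - p x.
  by apply/eqP; rewrite -addr_eq0 -pD addNr (sublinear0 sp).
exists p => // a x y; rewrite pD; congr (_ + _).
have [a0|/ltW a0] := leP 0 a; first exact: sp.2.
rewrite -[a]opprK scaleNr pNE sp.2 ?oppr_ge0//.
by rewrite -mulNr.
Qed.

End sublinear.

(** * Weak stability of eps-isometries *)

Lemma norm_sublinear (R : realType) (V : normedModType R) :
  sublinear (fun x : V => `|x|).
Proof.
split=> [x y|a x a0]; first exact: ler_normD.
by rewrite normrZ ger0_norm.
Qed.

(** A linear functional below the norm straightened at [x0] automatically attains
its norm there. *)
Lemma norming_functional (R : realType) (V : normedModType R) (x0 : V) :
  exists xi : V -> R^o, [/\ linear xi, forall x, `|xi x| <= `|x| & xi x0 = `|x0|].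
Proof.
have sn := norm_sublinear V.
have [xi xiL xile] := hahn_banach (straighten_sublinear x0 sn).
have xi_le x : xi x <= `|x| by exact: le_trans (xile x) (straighten_le _ sn _).
pose X := GRing.isLinear.Build _ _ _ _ xi xiL.
pose xl : {linear V -> R^o} := HB.pack xi X.
have xiN x : xi (- x) = - xi x by exact: (linearN xl).
have xi_norm x : `|xi x| <= `|x|.
  by rewrite ler_norml xi_le andbT lerNl -xiN -[leRHS]normrN.
exists xi; split => //; apply/le_anti; rewrite xi_le/= -lerN2 -xiN.
exact: le_trans (xile _) (straightenN _ sn).
Qed.

Section eps_isometry.
Context (R : realType) (Z Y : completeNormedModType R) (eps : R) (f : Z -> Y).
Hypothesis ff : standard_eps_isometry eps f.

Let f0 : f 0 = 0. Proof. by case: ff. Qed.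

Let f_ub x y : `|f x - f y| <= `|x - y| + eps.
Proof. by have := ff.2 x y; rewrite ler_distl => /andP[_]. Qed.

Let f_lb x y : `|x - y| - eps <= `|f x - f y|.
Proof. by have := ff.2 x y; rewrite ler_distl => /andP[]. Qed.

(** The lower bound on |sum_i l_i f(z_i)| in terms of a sublinear function [p];
the pairs in [s] are the (l_i, z_i).  For linear [p] the left-hand side is
p (sum_i l_i z_i).  Quantifying over the base point [a] makes the condition
invariant under translation, and therefore stable under [straighten]. *)
Definition controlled (p : Z -> R) := forall a (s : seq (R * Z)),
  \sum_(w <- s) `|w.1| * (p a - p (a - Num.sg w.1 *: w.2)) <=
  `|\sum_(w <- s) w.1 *: f w.2| + 3 * eps * \sum_(w <- s) `|w.1|.

(** Write |l| (f a - f (- a)) as l f z plus a remainder.  If l > 0 the remainder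
is l times (f a - f z) + (f 0 - f (- a)); if l < 0 it is |l| times
(f a - f 0) + (f z - f (- a)).  Each difference is estimated by the isometry
condition, and |f a - f (- a)| >= 2 |a| - eps, so three errors eps occur. *)
Lemma norm_controlled : controlled (fun x => `|x|).
Proof.
move=> a s.
set S := \sum_(w <- s) `|w.1|.
pose r (w : R * Z) := `|w.1| *: (f a - f (- a)) - w.1 *: f w.2.
have S0 : 0 <= S by exact: sumr_ge0.
have rle w : `|r w| <= `|w.1| * (`|a - Num.sg w.1 *: w.2| + `|a| + 2 * eps).
  have na x : `|f a - f x| + `|f 0 - f (- a)| <= `|a - x| + `|a| + 2 * eps.
    have := f_ub a x; have := f_ub 0 (- a); rewrite sub0r opprK; lra.
  have na' x : `|f a - f 0| + `|f x - f (- a)| <= `|a + x| + `|a| + 2 * eps.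
    have := f_ub x (- a); have := f_ub a 0; rewrite opprK subr0 (addrC x); lra.
  rewrite /r; case: w => l x /=; have [l0|l0|->] := ltgtP l 0.
  - rewrite (ltr0_norm l0) ltr0_sg// scaleN1r opprK.
    rewrite scaleNr -opprD -scalerDr normrN normrZ (ltr0_norm l0).
    apply: ler_wpM2l; first by rewrite oppr_ge0 ltW.
    apply: le_trans (na' x); rewrite f0 subr0 -addrA (addrC (- _)).
    exact: ler_normD.
  - rewrite (gtr0_norm l0) gtr0_sg// scale1r -scalerBr normrZ (gtr0_norm l0).
    apply: ler_wpM2l; first exact: ltW.
    apply: le_trans (na x); rewrite f0 sub0r addrAC.
    exact: ler_normD.
  - by rewrite normr0 !scale0r subr0 normr0 mul0r.
have E : S *: (f a - f (- a)) = \sum_(w <- s) w.1 *: f w.2 + \sum_(w <- s) r w.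
  rewrite -big_split/= /S scaler_suml; apply: eq_bigr => w _.
  by rewrite /r addrC subrK.
have h1 : S * (2 * `|a| - eps) <= `|S *: (f a - f (- a))|.
  rewrite normrZ (ger0_norm S0) ler_wpM2l//.
  have := f_lb a (- a); rewrite opprK -mulr2n normrMn; lra.
have h2 : `|S *: (f a - f (- a))| <= `|\sum_(w <- s) w.1 *: f w.2|
    + \sum_(w <- s) `|w.1| * (`|a - Num.sg w.1 *: w.2| + `|a| + 2 * eps).
  rewrite E (le_trans (ler_normD _ _))// lerD2l.
  by rewrite (le_trans (ler_norm_sum _ _ _))// ler_sum.
have h3 : \sum_(w <- s) `|w.1| * (`|a - Num.sg w.1 *: w.2| + `|a| + 2 * eps) +
    \sum_(w <- s) `|w.1| * (`|a| - `|a - Num.sg w.1 *: w.2|)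
    = S * (2 * `|a| + 2 * eps).
  rewrite -big_split /S mulr_suml/=; apply: eq_bigr => w _; ring.
lra.
Qed.

(** At a large time [t] the values of [straighten p e] at the finitely many points
involved are those of p (_ + t e) - t p e up to a small error; the terms t p e
cancel in the differences, leaving the condition for [p] at a + t e. *)
Lemma straighten_controlled p e : sublinear p -> controlled p ->
  controlled (straighten p e).
Proof.
move=> sp cp a s; set S := \sum_(w <- s) `|w.1|.
have S0 : 0 <= S by exact: sumr_ge0.
apply/ler_addgt0Pr => d d0.
pose d' := d / (S + 1).
have d'0 : 0 < d' by rewrite divr_gt0// ltr_wpDl.
have Sd : S * d' <= d.
  by rewrite mulrA ler_pdivrMr ?ltr_wpDl// mulrC ler_wpM2l ?ltW// ltrDl.
have [t t0 ts] := straighten_approx e sp [seq a - Num.sg w.1 *: w.2 | w <- s] d'0.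
have := cp (a + t *: e) s.
suff : \sum_(w <- s) `|w.1| * (straighten p e a - straighten p e (a - Num.sg w.1 *: w.2))
  <= \sum_(w <- s) `|w.1| * (p (a + t *: e) -
       p (a + t *: e - Num.sg w.1 *: w.2)) + S * d'.
  rewrite -/S; lra.
rewrite /S mulr_suml -big_split/= big_seq [leRHS]big_seq; apply: ler_sum => w ws.
rewrite -mulrDr ler_wpM2l//.
have /ts := map_f (fun w => a - Num.sg w.1 *: w.2) ws.
have := straighten_le_at e sp a t0.
rewrite (addrAC a (- _)); lra.
Qed.

(** One straightening for each vector of [es]; the last clause says that the
result is odd, hence linear, along each of them. *)
Lemma straighten_all (es : seq Z) p : sublinear p -> controlled p ->
  exists p', [/\ sublinear p', controlled p', forall x, p' x <= p x &
    forall e, e \in es -> p' e + p' (- e) <= 0].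
Proof.
elim: es p => [|e es IH] p sp cp; first by exists p; split.
have [p' [sp' cp' p'p p'es]] :=
  IH _ (straighten_sublinear e sp) (straighten_controlled e sp cp).
exists p'; split=> // [x|x]; first exact: le_trans (p'p x) (straighten_le _ sp _).
rewrite inE => /predU1P[->|]; last exact: p'es.
have := p'p (- e); have := p'p e; have := straightenN e sp.
have := straighten_le e sp e; lra.
Qed.

(** This is weak stability in dual form, free of functionals.  Straightening at
the combination [z0] first ensures that the final sublinear function still
equals the norm at [z0]. *)
Lemma eps_isometry_combination (s : seq (R * Z)) :
  `|\sum_(w <- s) w.1 *: w.2| <=
  `|\sum_(w <- s) w.1 *: f w.2| + 3 * eps * \sum_(w <- s) `|w.1|.
Proof.
set z0 := \sum_(w <- s) w.1 *: w.2.
have sn := norm_sublinear Z.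
have [p [sp cp pn ps]] := straighten_all [seq w.2 | w <- s]
  (straighten_sublinear z0 sn) (straighten_controlled z0 sn norm_controlled).
have pz : `|z0| <= p z0.
  have := pn (- z0); have := straightenN z0 sn; have := sublinear_geN z0 sp; lra.
apply: le_trans pz _; apply: le_trans (sublinear_sum _ _ sp) _.
apply: le_trans (cp 0 s); rewrite big_seq [leRHS]big_seq; apply: ler_sum => w ws.
rewrite -{1}(mulr_sg_norm w.1) mulrC -scalerA sp.2// ler_wpM2l//.
rewrite (sublinear0 sp) !sub0r.
have := ps _ (map_f snd ws) => /=.
case: (sgrP w.1) => _;
  rewrite ?scale0r ?oppr0 ?(sublinear0 sp) ?scaleN1r ?scale1r ?opprK; lra.
Qed.

(** The sublinear function F y = inf_s F_s y below is designed so that any linear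
phi <= F satisfies all requirements: the empty combination gives
phi y <= B |y|, and the combinations f z and - f z give the two halves of the
estimate.  The infimum is finite by [eps_isometry_combination]. *)
Theorem weak_stability (xi : Z -> R^o) (B : R) : linear xi -> 0 <= B ->
    (forall z, `|xi z| <= B * `|z|) ->
  exists phi : Y -> R^o, [/\ linear phi, forall y, `|phi y| <= B * `|y| &
    forall z, `|phi (f z) - xi z| <= 3 * eps * B].
Proof.
move=> xiL B0 xiB.
pose xl : {linear Z -> R^o} := HB.pack xi (GRing.isLinear.Build _ _ _ _ xi xiL).
have xD z z' : xi (z + z') = (xi z + xi z')%R :> R by exact: (linearD xl).
have xZ a z : xi (a *: z) = (a * xi z)%R :> R by exact: (linearZZ xl).
have x0 : xi 0 = 0 :> R by exact: (linear0 xl).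
have xN z : xi (- z) = (- xi z)%R :> R by exact: (linearN xl).
pose F (s : seq (R * Z)) (y : Y) := B * `|y - \sum_(w <- s) w.1 *: f w.2|
  + 3 * eps * B * (\sum_(w <- s) `|w.1|) + xi (\sum_(w <- s) w.1 *: w.2).
have Flb y : exists M : R, forall s, setT s -> M <= F s y.
  exists (- (B * `|y|)) => s _; rewrite /F.
  set z0 := \sum_(w <- s) w.1 *: w.2; set w0 := \sum_(w <- s) w.1 *: f w.2.
  have /ler_normlP[h1 _] := xiB z0.
  have h2 : B * `|z0| <= B * (`|w0| + 3 * eps * \sum_(w <- s) `|w.1|).
    by rewrite ler_wpM2l// eps_isometry_combination.
  have h3 : B * `|w0| <= B * (`|y| + `|y - w0|).
    rewrite ler_wpM2l// -[w0 in leLHS](subKr y).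
    exact: ler_normB.
  lra.
have sF : sublinear (infimum setT F).
  apply: infimum_sublinear => //; first by exists [::].
    move=> s t x y _ _; exists (s ++ t) => //.
    rewrite /F !big_cat/= xD.
    set a := \sum_(w <- s) w.1 *: f w.2; set b := \sum_(w <- t) w.1 *: f w.2.
    have : B * `|x + y - (a + b)| <= B * (`|x - a| + `|y - b|).
      by rewrite ler_wpM2l// opprD addrACA ler_normD.
    lra.
  move=> s a x _ a0; exists [seq (a * w.1, w.2) | w <- s] => //.
  rewrite /F !big_map/=.
  have scale_out (W : lmodType R) (h : Z -> W) :
      \sum_(w <- s) (a * w.1) *: h w.2 = a *: \sum_(w <- s) w.1 *: h w.2.
    by rewrite scaler_sumr; apply: eq_bigr => w _; rewrite scalerA.
  have -> : \sum_(w <- s) `|a * w.1| = a * \sum_(w <- s) `|w.1|.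
    by rewrite mulr_sumr; apply: eq_bigr => w _; rewrite normrM gtr0_norm.
  rewrite (scale_out _ f) (scale_out _ id) xZ -scalerBr normrZ (gtr0_norm a0); lra.
have [phi phiL phiF] := hahn_banach sF.
pose pl : {linear Y -> R^o} := HB.pack phi (GRing.isLinear.Build _ _ _ _ phi phiL).
have phiN x : phi (- x) = - phi x by exact: (linearN pl).
have phi_le s y : phi y <= F s y.
  exact: le_trans (phiF y) (infimum_le Flb _ _).
have phiB y : phi y <= B * `|y|.
  have := phi_le [::] y.
  by rewrite /F !big_nil subr0 x0 mulr0 !addr0.
exists phi; split => // [y|z].
  by rewrite ler_norml phiB andbT lerNl -phiN -[X in B * X]normrN.
have h1 := phi_le [:: (1, z)] (f z).
have h2 := phi_le [:: (-1, z)] (- f z).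
move: h1 h2; rewrite /F !big_cons !big_nil /= !addr0 !scale1r !scaleN1r opprK.
rewrite subrr addNr normr0 normrN normr1 xN phiN => h1 h2.
by rewrite ler_norml; apply/andP; split; lra.
Qed.

End eps_isometry.

(** * Transport along a linear isomorphism *)

(** An l_oo-valued operator is a uniformly bounded family of functionals, so
l_oo inherits weak stability coordinate by coordinate with the same constants. *)
Lemma weak_stability_linf (R : realType) (Z Y : completeNormedModType R)
    (I : Type) (eps : R) (f : Z -> Y) (xi : I -> Z -> R^o) (B : R) :
    standard_eps_isometry eps f -> (forall i, linear (xi i)) ->
    0 <= B -> (forall i z, `|xi i z| <= B * `|z|) ->
  exists S : Y -> linf I R, [/\ linear S, forall y, `|S y| <= B * `|y| &
    forall z i, `|S (f z) i - xi i z| <= 3 * eps * B].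
Proof.
move=> ff xiL B0 xiB.
have /choice[phi phiP] i := weak_stability ff (xiL i) B0 (xiB i).
have phib y : (phi^~ y : I -> R^o) \in @bounded_family I R.
  by apply/asboolP; exists (B * `|y|) => i; have [_ h _] := phiP i.
exists (fun y => Linf (phib y)); split.
- move=> a x y; apply/val_inj/funext => i /=.
  by have [h _ _] := phiP i; exact: h.
- move=> y; apply: linf_norm_le => [|i]; first exact: mulr_ge0.
  by have [_ h _] := phiP i; exact: h.
- by move=> z i; have [_ _ h] := phiP i; exact: h.
Qed.

Lemma closed_linear_span_image (R : realType) (V W : completeNormedModType R)
    (S : V -> W) (B : R) (A : set V) (A' : set W) :
    linear S -> (forall v, `|S v| <= B * `|v|) -> (forall v, A v -> A' (S v)) ->
  forall v, closed_linear_span A v -> closed_linear_span A' (S v).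
Proof.
move=> SL SB AA'.
pose Sl : {linear V -> W} := HB.pack S (GRing.isLinear.Build _ _ _ _ S SL).
have Sc : continuous Sl.
  apply: bounded_linear_continuous; apply/linear_boundedP.
  near=> r => v; apply: le_trans (SB v) _; rewrite ler_wpM2r//.
have Sspan v : linear_span A v -> linear_span A' (S v).
  move=> [n [a [w [Aw ->]]]]; exists n, a, (S \o w); split=> [i|].
    exact/AA'/Aw.
  rewrite -[S _]/(Sl _) linear_sum; apply: eq_bigr => i _.
  exact: (linearZZ Sl).
move=> v Av U /(Sc v)/Av[w [Aw Uw]].
by exists (S w); split=> //; exact: Sspan.
Unshelve. all: by end_near. Qed.

(** The constant in [bounded_on] may be negative when the domain is trivial. *)
Lemma bounded_on_pos (R : realType) (V W : completeNormedModType R)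
    (D : set V) (T : V -> W) : bounded_on D T ->
  exists2 M : R, 0 < M & forall v, D v -> `|T v| <= M * `|v|.
Proof.
move=> [M TM]; exists (`|M| + 1); first by rewrite ltr_wpDl.
move=> v Dv; apply: le_trans (TM v Dv) _; rewrite ler_wpM2r//.
by rewrite (le_trans (ler_norm M))// lerDl.
Qed.

Theorem corollary3p4 (R : realType) (X Z : completeNormedModType R)
    (hXZ : linearly_isomorphic X Z) (hX : universally_left_stable X) :
  universally_left_stable Z.
Proof.
move: hXZ => [u [v [uv vu /bounded_on_pos[A A0 uA] /bounded_on_pos[B B0 vB]]]].
have vL : linear v.
  by move=> a z w; apply: (can_inj uv); rewrite vu linearP !vu.
have /choice[xi xiP] := @norming_functional R X.
have xivL i : linear (xi i \o v).
  by move=> a z w /=; rewrite vL; have [h _ _] := xiP i; exact: h.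
have xivB i z : `|(xi i \o v) z| <= B * `|z|.
  have [_ h _] := xiP i; exact: le_trans (h _) (vB _ I).
move=> Y.
have [gamma gamma0 stable] := hX (linf X R).
exists (A * gamma * (6 * B)); first by rewrite !mulr_gt0.
move=> eps f eps0 ff.
have [S [SL SB Sf]] := weak_stability_linf ff xivL (ltW B0) xivB.
pose Sl : {linear Y -> linf X R} := HB.pack S (GRing.isLinear.Build _ _ _ _ S SL).
pose g := S \o f \o u.
have gx x i : `|g x i - xi i x| <= 3 * eps * B.
  by have := Sf (u x) i; rewrite /= uv.
have xiB i x y : xi i x - xi i y = xi i (x - y).
  have [h _ _] := xiP i.
  by rewrite addrC -scaleN1r -h scaleN1r addrC.
(* The lower bound for |g x - g y| is read off the coordinate x - y, whose
   functional attains the norm of x - y. *)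
have gg : standard_eps_isometry (6 * B * eps) g.
  split; first by rewrite /g /= linear0 ff.1; exact: (linear0 Sl).
  move=> x y; rewrite ler_distl; apply/andP; split.
    have : `|g x (x - y) - g y (x - y)| <= `|g x - g y|.
      exact: (linf_norm_ub (g x - g y) (x - y)).
    have [_ _] := xiP (x - y); rewrite -xiB => xixy.
    have := gx x (x - y); have := gx y (x - y).
    rewrite !ler_norml => /andP[? ?] /andP[? ?] /andP[? ?].
    lra.
  apply: linf_norm_le => [|i].
    by rewrite addr_ge0 ?mulr_ge0// ltW.
  rewrite -[X in `|X|]/(g x i - g y i).
  have [_ h _] := xiP i; have := h (x - y); rewrite -xiB.
  have := gx x i; have := gx y i.
  rewrite !ler_norml /= => /andP[? ?] /andP[? ?] /andP[? ?].
  by apply/andP; split; lra.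
have [|T [TL /bounded_on_pos[M M0 TM] Tg]] := stable _ _ _ gg.
  by rewrite !mulr_ge0// ltW.
have SLf y : closed_linear_span (range f) y -> closed_linear_span (range g) (S y).
  apply: (closed_linear_span_image SL SB) => _ [z _ <-].
  by exists (v z) => //; rewrite /g /= vu.
exists (u \o T \o S); split.
- by move=> a y z /SLf Ly /SLf Lz /=; rewrite SL TL// linearP.
- exists (A * (M * B)) => y /SLf Ly /=.
  rewrite (le_trans (uA _ I))// -mulrA (ler_wpM2l (ltW A0))//.
  by rewrite (le_trans (TM _ Ly))// -mulrA (ler_wpM2l (ltW M0)).
- move=> z; have := Tg (v z); rewrite /g /= vu => Tz.
  rewrite -{2}(vu z) -linearB (le_trans (uA _ I))//.
  by rewrite (le_trans (ler_wpM2l (ltW A0) Tz))// !mulrA.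
Qed.
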